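(* Let $p$ be a prime and let $G$ be a finite $p$-group of nilpotency class $c$. Let $n=\lceil\log_p(c+1)\rceil$. Then $\exp([G,G^{\varphi}])$ divides $\exp(G)^n$.
   Context: Conventions: $x^y=y^{-1}xy$ and $[x,y]=x^{-1}y^{-1}xy$. $\exp(H)$ is the exponent of $H$. For a group $G$, let $\varphi:G\to G^{\varphi}$, $g\mapsto g^{\varphi}$, be an isomorphism onto a copy $G^{\varphi}$ of $G$, and define $\nu(G)$ to be the group generated by $G\cup G^{\varphi}$ (keeping all relations of $G$ and of $G^\varphi$) subject to the additional relations $[g_1,g_2^{\varphi}]^{g_3}=[g_1^{g_3},(g_2^{g_3})^{\varphi}]=[g_1,g_2^{\varphi}]^{g_3^{\varphi}}$ for all $g_1,g_2,g_3\in G$. The subgroup $[G,G^{\varphi}]=\langle [g,h^{\varphi}] : g,h\in G\rangle$ of $\nu(G)$ is identified with the non-abelian tensor square $G\otimes G$ (the group generated by symbols $g\otimes h$, $g,h\in G$, subject to $gg_1\otimes h=(g^{g_1}\otimes h^{g_1})(g_1\otimes h)$ and $g\otimes hh_1=(g\otimes h_1)(g^{h_1}\otimes h^{h_1})$ for all $g,g_1,h,h_1\in G$) via the isomorphism $g\otimes h\mapsto[g,h^{\varphi}]$. *)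

(* Defs.v *)
From HB Require Import structures.
From mathcomp Require Import all_boot all_fingroup all_solvable.
From mathcomp Require Import boolp classical_sets.
From mathcomp Require Import generic_quotient.

Set Implicit Arguments.
Unset Strict Implicit.
Unset Printing Implicit Defensive.

Local Open Scope group_scope.
Local Open Scope quotient_scope.

(* Subgroups of a possibly infinite group, as classical sets *)

Definition is_subgroup (T : groupType) (H : set T) : Prop :=
  H 1 /\ (forall x y, H x -> H y -> H (x * y^-1)).

Definition gen_subgroup (T : groupType) (A : set T) : set T :=
  smallest (@is_subgroup T) A.

(* The least positive exponent of the elements of H, and 0 when H has no
   finite exponent; thus [exp_of H %| m] with [0 < m] entails that H has
   finite exponent. *)
Definition is_expo (T : groupType) (H : set T) (e : nat) : bool :=
  (0 < e)%N && `[< forall x, H x -> x ^+ e = 1 >].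

Definition exp_of (T : groupType) (H : set T) : nat :=
  if pselect (exists e, is_expo H e) is left He then ex_minn He else 0%N.

(* The group nu(G). Its elements are words in the letters [inl g] (standing for
   g) and [inr g] (standing for g^phi), up to the least congruence containing
   the defining relations. Every letter has an inverse letter, so this monoid
   presentation presents a group, the one with the same generators and
   relations as a group presentation (see [nu_universal]). *)

Section NuDef.
Variable gT : groupType.
Local Notation word := (seq (gT + gT)).

Definition invl (a : gT + gT) : gT + gT :=
  match a with inl g => inl g^-1 | inr g => inr g^-1 end.

Definition winv (u : word) : word := rev (map invl u).
Definition wconj (u v : word) : word := winv v ++ u ++ v.
Definition wcomm (u v : word) : word := winv u ++ winv v ++ u ++ v.

Inductive nu_rel : word -> word -> Prop :=
| nu_rel_l1 : nu_rel [:: inl 1] [::]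
| nu_rel_lM g h : nu_rel [:: inl g; inl h] [:: inl (g * h)]
| nu_rel_r1 : nu_rel [:: inr 1] [::]
| nu_rel_rM g h : nu_rel [:: inr g; inr h] [:: inr (g * h)]
| nu_rel_Jl g1 g2 g3 :
    nu_rel (wconj (wcomm [:: inl g1] [:: inr g2]) [:: inl g3])
           (wcomm [:: inl (g1 ^ g3)] [:: inr (g2 ^ g3)])
| nu_rel_Jr g1 g2 g3 :
    nu_rel (wcomm [:: inl (g1 ^ g3)] [:: inr (g2 ^ g3)])
           (wconj (wcomm [:: inl g1] [:: inr g2]) [:: inr g3]).

Inductive nu_eqv : word -> word -> Prop :=
| nu_eqv_rel u v : nu_rel u v -> nu_eqv u v
| nu_eqv_refl u : nu_eqv u u
| nu_eqv_sym u v : nu_eqv u v -> nu_eqv v u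
| nu_eqv_trans v u w : nu_eqv u v -> nu_eqv v w -> nu_eqv u w
| nu_eqv_cat u u' v v' :
    nu_eqv u u' -> nu_eqv v v' -> nu_eqv (u ++ v) (u' ++ v').

Definition nu_eqb (u v : word) : bool := `[< nu_eqv u v >].

Lemma nu_eqb_refl : reflexive nu_eqb.
Proof. by move=> u; apply/asboolP; exact: nu_eqv_refl. Qed.

Lemma nu_eqb_sym : symmetric nu_eqb.
Proof. by move=> u v; apply/asboolP/asboolP; exact: nu_eqv_sym. Qed.

Lemma nu_eqb_trans : transitive nu_eqb.
Proof.
move=> v u w /asboolP uv /asboolP vw.
by apply/asboolP; exact: nu_eqv_trans uv vw.
Qed.

Canonical nu_equiv := EquivRel nu_eqb nu_eqb_refl nu_eqb_sym nu_eqb_trans.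

Definition nu := {eq_quot nu_equiv}.

HB.instance Definition _ := Choice.on nu.
HB.instance Definition _ := Quotient.on nu.

Lemma nu_piP u v : reflect (nu_eqv u v) (\pi_nu u == \pi_nu v :> nu).
Proof. by apply: (iffP eqP) => [/eqquotP/asboolP|uv]; last exact/eqquotP/asboolP. Qed.

Lemma nu_eqv_repr u : nu_eqv (repr (\pi_nu u : nu)) u.
Proof. by apply/nu_piP; rewrite reprK. Qed.

Definition nu_of (u : word) : nu := \pi_nu u.
Definition nu_mul (x y : nu) : nu := nu_of (repr x ++ repr y).
Definition nu_inv (x : nu) : nu := nu_of (winv (repr x)).

Lemma nu_of_surj (x : nu) : exists u, x = nu_of u.
Proof. by exists (repr x); rewrite /nu_of reprK. Qed.

Lemma nu_ofM u v : nu_mul (nu_of u) (nu_of v) = nu_of (u ++ v).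
Proof. by apply/eqP/nu_piP; apply: nu_eqv_cat; exact: nu_eqv_repr. Qed.

Lemma nu_mulA : associative nu_mul.
Proof.
move=> x y z; have [u ->] := nu_of_surj x; have [v ->] := nu_of_surj y.
by have [w ->] := nu_of_surj z; rewrite !nu_ofM catA.
Qed.

Lemma nu_mul1 : left_id (nu_of [::]) nu_mul.
Proof. by move=> x; have [u ->] := nu_of_surj x; rewrite nu_ofM. Qed.

Lemma nu_1mul : right_id (nu_of [::]) nu_mul.
Proof. by move=> x; have [u ->] := nu_of_surj x; rewrite nu_ofM cats0. Qed.

Lemma nu_eqv_invl a : nu_eqv [:: invl a; a] [::].
Proof.
case: a => g /=.
  apply: (@nu_eqv_trans [:: inl 1]); last exact/nu_eqv_rel/nu_rel_l1.
  by rewrite -(mulVg g); apply/nu_eqv_rel/nu_rel_lM.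
apply: (@nu_eqv_trans [:: inr 1]); last exact/nu_eqv_rel/nu_rel_r1.
by rewrite -(mulVg g); apply/nu_eqv_rel/nu_rel_rM.
Qed.

Lemma nu_eqv_winvl u : nu_eqv (winv u ++ u) [::].
Proof.
elim: u => [|a u IH]; first exact: nu_eqv_refl.
rewrite /winv map_cons rev_cons cat_rcons.
apply: nu_eqv_trans IH; rewrite -/(winv u).
apply: nu_eqv_cat; first exact: nu_eqv_refl.
apply: (@nu_eqv_cat [:: invl a; a] [::] u u); last exact: nu_eqv_refl.
exact: nu_eqv_invl.
Qed.

Lemma nu_mulV : left_inverse (nu_of [::]) nu_inv nu_mul.
Proof.
move=> x; rewrite -[X in nu_mul _ X]reprK nu_ofM.
exact/eqP/nu_piP/nu_eqv_winvl.
Qed.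

Lemma nu_Vmul : right_inverse (nu_of [::]) nu_inv nu_mul.
Proof.
move=> x; rewrite -[LHS]nu_mul1 -(nu_mulV (nu_inv x)) -nu_mulA.
by rewrite (nu_mulA (nu_inv x)) nu_mulV nu_mul1.
Qed.

HB.instance Definition _ :=
  isGroup.Build nu nu_mulA nu_mul1 nu_1mul nu_mulV nu_Vmul.

Definition nul (g : gT) : nu := nu_of [:: inl g].
Definition nur (g : gT) : nu := nu_of [:: inr g].

Lemma nul_morph : {morph nul : x y / x * y}.
Proof.
move=> g h; rewrite [RHS]nu_ofM; apply/esym/eqP/nu_piP.
exact/nu_eqv_rel/nu_rel_lM.
Qed.

Lemma nur_morph : {morph nur : x y / x * y}.
Proof.
move=> g h; rewrite [RHS]nu_ofM; apply/esym/eqP/nu_piP.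
exact/nu_eqv_rel/nu_rel_rM.
Qed.

Lemma nu_ofV u : (nu_of u)^-1 = nu_of (winv u).
Proof.
apply: (mulIg (nu_of u)); rewrite mulVg [RHS]nu_ofM.
by apply/esym/eqP/nu_piP/nu_eqv_winvl.
Qed.

Lemma nu_ofJ u v : nu_of u ^ nu_of v = nu_of (wconj u v).
Proof. by rewrite /conjg nu_ofV /wconj -!nu_ofM. Qed.

Lemma nu_ofR u v : [~ nu_of u, nu_of v] = nu_of (wcomm u v).
Proof. by rewrite commgEl nu_ofJ nu_ofV /wconj /wcomm -!nu_ofM. Qed.

Lemma nu_relationl g1 g2 g3 :
  [~ nul g1, nur g2] ^ nul g3 = [~ nul (g1 ^ g3), nur (g2 ^ g3)].
Proof.
by rewrite !nu_ofR nu_ofJ; apply/eqP/nu_piP/nu_eqv_rel/nu_rel_Jl.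
Qed.

Lemma nu_relationr g1 g2 g3 :
  [~ nul (g1 ^ g3), nur (g2 ^ g3)] = [~ nul g1, nur g2] ^ nur g3.
Proof.
by rewrite !nu_ofR nu_ofJ; apply/eqP/nu_piP/nu_eqv_rel/nu_rel_Jr.
Qed.

Lemma nu_universal (K : groupType) (f g : gT -> K) :
    {morph f : x y / x * y} -> {morph g : x y / x * y} ->
    (forall g1 g2 g3 : gT,
       [~ f g1, g g2] ^ f g3 = [~ f (g1 ^ g3), g (g2 ^ g3)] /\
       [~ f (g1 ^ g3), g (g2 ^ g3)] = [~ f g1, g g2] ^ g g3) ->
  exists! F : nu -> K,
    [/\ {morph F : x y / x * y}, F \o nul = f & F \o nur = g].
Proof.
move=> fM gM fgJ.
have f1 : f 1 = 1 by apply: (mulgI (f 1)); rewrite -fM !mulg1.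
have g1 : g 1 = 1 by apply: (mulgI (g 1)); rewrite -gM !mulg1.
have fV x : f x^-1 = (f x)^-1 by apply: (mulIg (f x)); rewrite -fM !mulVg.
have gV x : g x^-1 = (g x)^-1 by apply: (mulIg (g x)); rewrite -gM !mulVg.
pose ev := foldr (fun (a : gT + gT) (z : K) =>
  (match a with inl x => f x | inr x => g x end) * z) 1.
have evM u v : ev (u ++ v) = ev u * ev v.
  by elim: u => [|a u IH]; rewrite /= ?mul1g // IH mulgA.
have evV u : ev (winv u) = (ev u)^-1.
  elim: u => [|a u IH]; first by rewrite /= invg1.
  rewrite /winv map_cons rev_cons -cats1 evM -/(winv u) IH /= mulg1 invgM.
  by case: a => x; rewrite /= ?fV ?gV.
have evJ u v : ev (wconj u v) = ev u ^ ev v by rewrite !evM evV.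
have evR u v : ev (wcomm u v) = [~ ev u, ev v] by rewrite !evM !evV.
have ev_eqv u v : nu_eqv u v -> ev u = ev v.
  elim=> {u v} [u v uv|//|//|u v w _ -> _ -> //|u u' v v' _ Eu _ Ev].
    case: uv => [|x y||x y|x y z|x y z]; rewrite ?evJ ?evR /= ?mulg1 //.
    - by case: (fgJ x y z).
    - by case: (fgJ x y z).
  by rewrite !evM Eu Ev.
have evE u : ev (repr (nu_of u)) = ev u by apply/ev_eqv/nu_eqv_repr.
exists (fun x => ev (repr x)); split.
  split.
  - move=> x y; have [u ->] := nu_of_surj x; have [v ->] := nu_of_surj y.
    by rewrite [_ * _]nu_ofM !evE evM.
  - by apply/funext => x; rewrite /= evE /= mulg1.
  - by apply/funext => x; rewrite /= evE /= mulg1.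
move=> F [FM Fl Fr]; apply/funext => x; have [u ->] := nu_of_surj x.
rewrite evE; elim: u => [|a u IH].
  by apply: (mulgI (F 1)); rewrite -FM !mulg1.
rewrite /= {}IH -cat1s -nu_ofM FM; congr (_ * _).
by case: a => y; rewrite -?Fl -?Fr.
Qed.

(* [G, G^phi] *)
Definition nu_tensor : set nu :=
  gen_subgroup (fun z => exists g h : gT, z = [~ nul g, nur h]).

End NuDef.

Arguments nu_tensor gT : clear implicits.

(* Main.v *)
Require Import Defs.
From mathcomp Require Import boolp classical_sets.
From mathcomp Require Import all_boot all_fingroup all_solvable.

Set Implicit Arguments.
Unset Strict Implicit.
Unset Printing Implicit Defensive.

(** Write e = exp(G) = p^a, l and r for the two embeddings of G in nu(G), and
    M_s for the subgroup of nu(G) generated by the [l g, r h] with g in the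
    s-th lower central subgroup L_s of G; thus M_1 is [G, G^phi] and M_s = 1
    as soon as s > c. The whole theorem comes from one step
    ([lcn_tensor_pexp]): raising an element of M_s to the power e moves it into
    M_(p s). After n steps an element of [G, G^phi] lies in M_(p^n), which is
    trivial because p^n > c.

    Commutators. An element l g acts on M_0 as r g does, so that M_s acts on
    M_0 through L_(s+1). For g in L_s the map h |-> [l g, r h] is multiplicative
    modulo M_(s+1), which is the reason for [M_s, l G] <= M_(s+1)
    ([lcn_tensorR1]); from there [M_s, l L_i] <= M_(i+s) ([lcn_tensorRl]) and
    [M_s, M_t] <= M_(s+t) ([lcn_tensorR]).

    Powers. Modulo M_(p s), everything in sight has class less than p, and for
    such groups taking e-th powers is as good as additive when e is a power of
    p. This is the Hall-Petrescu formula, for which polynomial sequences are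
    used here: given a filtration H, the sequences f whose i-th iterated
    difference lies in H_i form a group ([polyseq_group]), and if f(0) = 1 then
    f(n) is a product of powers c_i^binom(n,i) with c_i in H_i. For n = p^a and
    0 < i < p the binomial is divisible by n, so f(e) is a product of e-th
    powers modulo H_p ([polyseq_pexp]). The step is proved by descending
    induction on j for M_j, s <= j: the tail c_2, c_3, ... lies in M_(j+1),
    where the claim is known, hence it disappears. The sequence
    y^-n x^-n (x y)^n shows that the elements with e-th power in M_(p s) form a
    subgroup ([pexp_of_product]); the sequence x^-n (x t)^n with x = l g and
    t = [l g, r h] shows that it contains the generators, since both x and
    x t = x^(r h) have trivial e-th power ([pexp_of_quotient]). *)

(** * Subgroups and commutators in an arbitrary group *)

Section Subgroups.
Local Open Scope group_scope.
Variable T : groupType.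
Implicit Types (N : set T) (x y z : T).

Lemma commMgJ_groupType x y z : [~ x * y, z] = [~ x, z] ^ y * [~ y, z].
Proof. by rewrite !commgEr conjgM mulgA -conjMg mulgK. Qed.

Lemma commgMJ_groupType x y z : [~ x, y * z] = [~ x, z] * [~ x, y] ^ z.
Proof. by rewrite !commgEl conjgM -mulgA -conjMg mulVKg. Qed.

(** The difference of the sequence [f, g] when f and g have differences a and
    b: every factor on the right involves a or b, so that it lies deeper in
    the filtration than [f, g]. *)
Lemma commg_increment f g a b (c := [~ f, g] : T) :
  c^-1 * [~ f * a, g * b] =
  ([~ f, b] ^ a * [~ a, b]) ^ c * [~ c, b] * ([~ c, a] * [~ a, g]) ^ b.
Proof.
rewrite commgMJ_groupType (commMgJ_groupType _ _ b) (commMgJ_groupType _ _ g)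
  -/c.
set x := _ * [~ a, b]; set y := [~ a, g].
have -> : c ^ a = c * [~ c, a] by rewrite commgEl mulVKg.
rewrite -(mulgA c) (conjMg c).
have -> : c ^ b = c * [~ c, b] by rewrite commgEl mulVKg.
by rewrite (conjgE x) !mulgA.
Qed.

Lemma is_subgroup1 N : is_subgroup N -> N 1.
Proof. by case. Qed.

Lemma is_subgroupV N x : is_subgroup N -> N x -> N x^-1.
Proof. by case=> N1 NB Nx; rewrite -(mul1g x^-1); apply: NB. Qed.

Lemma is_subgroupM N x y : is_subgroup N -> N x -> N y -> N (x * y).
Proof.
move=> sN Nx Ny; rewrite -[y]invgK; apply: sN.2 => //.
exact: is_subgroupV.
Qed.

Lemma is_subgroupX N x n : is_subgroup N -> N x -> N (x ^+ n).
Proof.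
move=> sN Nx; elim: n => [|n IHn]; first exact: is_subgroup1.
by rewrite expgS; apply: is_subgroupM.
Qed.

Lemma gen_subgroupP (A : set T) : is_subgroup (gen_subgroup A).
Proof.
split=> [B [sB _]|x y Ax Ay B sAB]; first exact: is_subgroup1.
by apply: sAB.1.2; [apply: Ax | apply: Ay].
Qed.

Lemma mem_gen_subgroup (A : set T) x : A x -> gen_subgroup A x.
Proof. exact: sub_gen_smallest. Qed.

Lemma gen_subgroup_ind (A P : set T) :
  is_subgroup P -> (forall x, A x -> P x) -> forall x, gen_subgroup A x -> P x.
Proof. by move=> sP AP x; apply: smallest_sub. Qed.

End Subgroups.

(** * Polynomial sequences in a filtered group *)

Section Polynomials.
Local Open Scope group_scope.
Variables (T : groupType) (H : nat -> set T).

Record filtration : Prop := Filtration {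
  filt_group : forall i, is_subgroup (H i);
  filtS : forall i x, H i.+1 x -> H i x;
  filtR : forall i j x y, H i x -> H j y -> H (i + j) [~ x, y]
}.

Definition delta (f : nat -> T) n := (f n)^-1 * f n.+1.

(** Polynomial sequences relative to H shifted by j, tested on the first d
    differences only. The bound d makes the closure properties provable by
    induction: the difference of [f, g] involves [f, g] itself again, which is
    available at depth d when depth d.+1 is examined. *)
Fixpoint polyseq_upto d j (f : nat -> T) : Prop :=
  (forall n, H j (f n)) /\
  (if d is d'.+1 then polyseq_upto d' j.+1 (delta f) else True).

Local Notation P := polyseq_upto.

Hypothesis fH : filtration.
Let sH := filt_group fH.

Lemma filt_leq i j x : i <= j -> H j x -> H i x.
Proof. by move/subnK <-; elim: (j - i) => // n IHn /(filtS fH)/IHn. Qed.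

Lemma polyseq0 d j f : P d j f -> forall n, H j (f n).
Proof. by case: d => [|d] []. Qed.

Lemma polyseqS d j f : P d.+1 j f -> P d j f.
Proof.
elim: d j f => [|d IHd] j f [Hf Pf]; split=> //.
exact: IHd.
Qed.

Lemma polyseq_leq d i j f : i <= j -> P d j f -> P d i f.
Proof.
elim: d i j f => [|d IHd] i j f le_ij [Hf Pf];
  (split; first by move=> n; apply: filt_leq le_ij (Hf n)) => //.
exact: IHd Pf.
Qed.

Lemma polyseq_cst1 d j : P d j (fun=> 1).
Proof.
elim: d j => [|d IHd] j; (split; first by move=> _; apply: is_subgroup1) => //.
by rewrite /delta invg1 mulg1.
Qed.

(** The Lazard-Leibman theorem. The three closure properties have to be proved
    together, as the differences of products and inverses contain conjugates,
    hence commutators, of sequences that are one level deeper. *)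
Lemma polyseq_group d :
  [/\ forall j f g, P d j f -> P d j g -> P d j (fun n => f n * g n),
      forall j f, P d j f -> P d j (fun n => (f n)^-1)
    & forall i j f g,
        P d i f -> P d j g -> P d (i + j) (fun n => [~ f n, g n])].
Proof.
elim: d => [|d [PM PV PR]].
  split=> [j f g [Hf _] [Hg _]|j f [Hf _]|i j f g [Hf _] [Hg _]]; split=> // n.
  - exact: is_subgroupM.
  - exact: is_subgroupV.
  - exact: filtR.
have PJ i j f g : P d i f -> P d j g -> P d i (fun n => f n ^ g n).
  move=> Pf Pg; have -> : (fun n => f n ^ g n) = fun n => f n * [~ f n, g n].
    by apply/funext => n; rewrite commgEl mulVKg.
  by apply: (PM) => //; apply: polyseq_leq (PR _ _ _ _ Pf Pg); apply: leq_addr.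
have deltaE (f : nat -> T) n : f n.+1 = f n * delta f n by rewrite mulVKg.
split.
- move=> j f g Pf Pg; split=> [n|].
    by apply: is_subgroupM => //; [apply: polyseq0 Pf n | apply: polyseq0 Pg n].
  have -> : delta (fun n => f n * g n) = fun n => delta f n ^ g n * delta g n.
    by apply/funext => n; rewrite {1}/delta !deltaE !gnorm conjgE !gnorm.
  by apply: (PM) Pg.2; apply: PJ Pf.2 (polyseqS Pg).
- move=> j f Pf; split=> [n|].
    by apply: is_subgroupV => //; apply: polyseq0 Pf n.
  have -> : delta (fun n => (f n)^-1) = fun n => (delta f n)^-1 ^ (f n)^-1.
    by apply/funext => n; rewrite {1}/delta !deltaE !gnorm conjgE !gnorm.
  by apply: PJ (PV _ _ Pf.2) (PV _ _ (polyseqS Pf)).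
move=> i j f g Pf Pg; split=> [n|].
  by apply: filtR => //; [apply: polyseq0 Pf n | apply: polyseq0 Pg n].
have [[_ Pa] [_ Pb]] := (Pf, Pg).
have {}Pf := polyseqS Pf; have {}Pg := polyseqS Pg.
set a := delta f in Pa; set b := delta g in Pb.
pose c n := [~ f n, g n]; have Pc : P d (i + j) c by apply: (PR).
have -> : delta (fun n => [~ f n, g n]) =
    fun n => ([~ f n, b n] ^ a n * [~ a n, b n]) ^ c n * [~ c n, b n]
             * ([~ c n, a n] * [~ a n, g n]) ^ b n.
  by apply/funext => n; rewrite {1}/delta !deltaE commg_increment.
apply: (PM); first apply: (PM); first apply: (PJ _ _ _ _ _ Pc).
- apply: (PM); first by apply: (PJ _ _ _ _ _ Pa); rewrite -addnS; apply: (PR).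
  by apply: polyseq_leq (PR _ _ _ _ Pa Pb); rewrite addSn addnS ltnW.
- by apply: polyseq_leq (PR _ _ _ _ Pc Pb); rewrite addnS ltnS leq_addr.
- apply: (PJ _ _ _ _ _ Pb); apply: (PM); last by rewrite -addSn; apply: (PR).
  by apply: polyseq_leq (PR _ _ _ _ Pc Pa); rewrite addnS ltnS leq_addr.
Qed.

Lemma polyseqM d j f g : P d j f -> P d j g -> P d j (fun n => f n * g n).
Proof. by have [PM _ _] := polyseq_group d; apply: PM. Qed.

Lemma polyseqV d j f : P d j f -> P d j (fun n => (f n)^-1).
Proof. by have [_ PV _] := polyseq_group d; apply: PV. Qed.

(** By Pascal's rule the difference of c^binom(n,s) is c^binom(n,s-1). *)
Lemma polyseq_bin d j s c : H (s + j) c -> P d j (fun n => c ^+ 'C(n, s)).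
Proof.
have Hf i t n : H (t + i) c -> H i (c ^+ 'C(n, t)).
  by move=> Hc; apply: is_subgroupX => //; apply: filt_leq Hc; apply: leq_addl.
elim: d j s => [|d IHd] j s Hc; (split; first by move=> n; apply: Hf) => //.
case: s Hc => [|s] Hc.
  have -> : delta (fun n => c ^+ 'C(n, 0)) = fun=> 1.
    by apply/funext => n; rewrite /delta !bin0 mulVg.
  exact: polyseq_cst1.
have -> : delta (fun n => c ^+ 'C(n, s.+1)) = fun n => c ^+ 'C(n, s).
  by apply/funext => n; rewrite /delta binS expgnDr mulKg.
by apply: IHd; rewrite addnS.
Qed.

Lemma polyseq_exp d x : H 1 x -> P d 0 (fun n => x ^+ n).
Proof.
move=> Hx; have := @polyseq_bin d 0 1 x Hx.
by congr P; apply/funext => n; rewrite bin1.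
Qed.

(** If f starts with r trivial terms, its i-th difference starts with r - i of
    them, so that f is built by iterated products out of its r-th difference,
    whose values lie in H_(r+j). For j = 0 this places the Taylor coefficient
    f(r) in H_r. *)
Lemma polyseq_vanish r j f :
  P r j f -> (forall i, i < r -> f i = 1) -> forall n, H (r + j) (f n).
Proof.
elim: r j f => [|r IHr] j f; first by move=> [Hf _] _ n; apply: Hf.
case=> [Hf Pf] f1.
have HD n : H (r.+1 + j) (delta f n).
  rewrite addSnnS; apply: IHr => // i lt_ir.
  by rewrite /delta !f1 ?invg1 ?mulg1 //; apply: ltnW.
elim=> [|n IHn]; first by rewrite f1 //; apply: is_subgroup1.
by rewrite -[f n.+1](mulVKg (f n)); apply: is_subgroupM (sH _) IHn (HD n).
Qed.

Lemma polyseqW d r j f : r <= d -> P d j f -> P r j f.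
Proof. by move/subnK <-; elim: (d - r) => // n IHn /polyseqS/IHn. Qed.

Variables (p k : nat) (N : set T).
Hypotheses (p_pr : prime p) (sN : is_subgroup N).
Hypothesis HpN : forall x, H p x -> N x.
Hypothesis H2N : forall x, H 2 x -> N (x ^+ (p ^ k)).
Let e := (p ^ k)%N.

(** r * binom(e, r) = e * binom(e - 1, r - 1) and r is prime to e. *)
Lemma dvdn_pexp_bin r : 0 < r < p -> e %| 'C(e, r).
Proof.
case: r => // r /= lt_rp.
have co_er : coprime e r.+1.
  by rewrite coprimeXl // prime_coprime // gtnNdvd.
rewrite -(Gauss_dvdr _ co_er) -mul_bin_diag.
exact: dvdn_mulr.
Qed.

(** Dividing by c^binom(n,r), with c = f(r), turns a sequence with r trivial
    initial terms into one with r + 1 of them, at the cost of an e-th power of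
    an element of H_2. A sequence with p trivial initial terms lies in H_p. *)
Lemma polyseq_vanish_pexp r f :
  1 < r <= p -> P p 0 f -> (forall i, i < r -> f i = 1) -> N (f e).
Proof.
case/andP=> lt1r le_rp; move: {2}(p - r) (erefl (p - r)) => m.
elim: m r lt1r le_rp f => [|m IHm] r lt1r le_rp f prE Pf f1.
  have Dr : r = p by apply/eqP; rewrite eqn_leq le_rp -subn_eq0 prE.
  by apply: HpN; rewrite -Dr -[r in H r]addn0; apply: polyseq_vanish;
    rewrite ?Dr // -Dr.
have lt_rp : r < p by rewrite -subn_gt0 prE.
have Hc : H r (f r).
  by rewrite -[r in H r]addn0; apply: polyseq_vanish => //; apply: polyseqW Pf.
pose g n := (f r ^+ 'C(n, r))^-1 * f n.
have Ng : N (g e).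
  apply: (IHm r.+1) => //; first exact: ltnW.
  - by rewrite subnS prE.
  - by apply: polyseqM => //; apply/polyseqV/polyseq_bin; rewrite addn0.
  move=> i; rewrite ltnS leq_eqVlt /g => /predU1P[->|lt_ir].
    by rewrite binn expg1 mulVg.
  by rewrite (bin_small lt_ir) (f1 _ lt_ir); apply: mulVg.
rewrite -[f e](mulVKg (f r ^+ 'C(e, r))); apply: is_subgroupM => //.
have /dvdnP[q ->] : e %| 'C(e, r) by apply: dvdn_pexp_bin;
  rewrite lt_rp (ltnW lt1r).
rewrite expgnA; apply: H2N; apply: is_subgroupX => //.
exact: filt_leq lt1r Hc.
Qed.

(** Only the linear Taylor coefficient f(1) contributes to f(e) modulo N. *)
Lemma polyseq_pexp f : P p 0 f -> f 0 = 1 -> N ((f 1%N ^+ e)^-1 * f e).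
Proof.
move=> Pf f0; pose g n := (f 1%N ^+ n)^-1 * f n.
have p_gt1 := prime_gt1 p_pr.
apply: (@polyseq_vanish_pexp 2 g).
- by rewrite p_gt1.
- apply: polyseqM => //; apply/polyseqV/polyseq_exp.
  apply: (@polyseq_vanish 1 0); first exact: polyseqW (prime_gt0 p_pr) Pf.
  by case.
case=> [|[|//]] _; first by rewrite /g f0 invg1 mulg1.
by rewrite /g mulVg.
Qed.

(** Apply [polyseq_pexp] to x^-n (x t)^n, whose linear coefficient is t. *)
Lemma pexp_of_quotient x t :
  H 1 x -> H 1 t -> x ^+ e = 1 -> (x * t) ^+ e = 1 -> N (t ^+ e).
Proof.
move=> Hx Ht xe xte; have Hxt : H 1 (x * t) by apply: is_subgroupM.
pose f n := (x ^+ n)^-1 * (x * t) ^+ n.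
have Pf : P p 0 f by apply/polyseqM/polyseq_exp=> //;
  apply/polyseqV/polyseq_exp.
have := polyseq_pexp Pf (mulVg 1).
rewrite /f xe xte !expg1 mulKg mulVg mulg1 => Nt.
by rewrite -[_ ^+ e]invgK; apply: is_subgroupV.
Qed.

(** Apply [polyseq_pexp] to y^-n x^-n (x y)^n, whose linear coefficient is
    trivial. *)
Lemma pexp_of_product x y :
  H 1 x -> H 1 y -> N (x ^+ e) -> N (y ^+ e) -> N ((x * y) ^+ e).
Proof.
move=> Hx Hy Nx Ny; have Hxy : H 1 (x * y) by apply: is_subgroupM.
pose f n := (y ^+ n)^-1 * (x ^+ n)^-1 * (x * y) ^+ n.
have Pf : P p 0 f.
  apply: polyseqM; last exact: polyseq_exp.
  by apply: polyseqM; apply/polyseqV/polyseq_exp.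
have f0 : f 0 = 1 by rewrite /f !invg1 !mulg1.
have := polyseq_pexp Pf f0.
have -> : f 1%N = 1 by rewrite /f !expg1 -invgM mulVg.
rewrite expg1n invg1 mul1g => Nf.
rewrite -[_ ^+ e](mulVKg (x ^+ e * y ^+ e)) invgM.
by do 2![apply: is_subgroupM => //].
Qed.

End Polynomials.

(** * The lower central series of a finite group *)

Section LowerCentral.
Local Open Scope group_scope.
Variable gT : finGroupType.
Local Notation G := [set: gT].
Implicit Types g h : gT.

(** The three subgroup lemma in G / L_(i+2). *)
Lemma lcn_comm_der1 i : [~: 'L_i(G), 'L_2(G)] \subset 'L_i.+2(G).
Proof.
have nLG (A : {set gT}) : A \subset 'N('L_i.+2(G)).
  exact: subset_trans (subsetT _) (lcn_norm _ _).
have LGG : [~: 'L_i(G), G, G] \subset 'L_i.+2(G).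
  exact: subset_trans (commSg _ (lcnSnS _ _)) (lcnSnS _ _).
rewrite lcn2 dergSn derg0 commGC -quotient_sub1 ?nLG // !quotientR ?nLG //.
apply/trivgP/three_subgroup; rewrite -!quotientR ?nLG //;
  apply: quotientS1 => //.
by rewrite [[~: G, _]]commGC.
Qed.

Lemma mem_lcn_leq i j g : i <= j -> g \in 'L_j(G) -> g \in 'L_i(G).
Proof. by move=> le_ij; apply: (subsetP (lcn_sub_leq _ le_ij)). Qed.

Lemma mem_lcnR i g h : g \in 'L_i(G) -> [~ g, h] \in 'L_i.+1(G).
Proof. by move=> gL; rewrite (subsetP (lcnSnS i _)) // mem_commg ?inE. Qed.

Lemma mem_lcn_der1R i g h :
  g \in 'L_i(G) -> h \in 'L_2(G) -> [~ g, h] \in 'L_i.+2(G).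
Proof. by move=> gL hL; rewrite (subsetP (lcn_comm_der1 i)) // mem_commg. Qed.

Lemma lcnJ i g h : (g ^ h \in 'L_i(G)) = (g \in 'L_i(G)).
Proof. by rewrite memJ_norm // (subsetP (lcn_norm i _)) ?inE. Qed.

Lemma mem_lcn_divJ i g h : g \in 'L_i(G) -> g ^ h * g^-1 \in 'L_i.+1(G).
Proof.
move=> gL; have -> : g ^ h * g^-1 = [~ g, h] ^ g^-1.
  by rewrite commgEl [RHS]conjgE invgK -!mulgA mulVKg.
by rewrite lcnJ mem_lcnR.
Qed.

End LowerCentral.

(** * The filtration of the tensor square by the lower central series *)

Section Tensor.
Local Open Scope group_scope.
Variable gT : finGroupType.
Local Notation G := [set: gT].
Local Notation l := (@nul gT).
Local Notation r := (@nur gT).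
Implicit Types (g h k u v d : gT) (x y z w : nu gT).

(** The definition is locked because a smallest subgroup unfolds to a product,
    into which the unifier would otherwise look. *)
Definition lcn_tensor s : set (nu gT) :=
  locked (gen_subgroup (fun z =>
    exists g h, g \in 'L_s(G) /\ z = [~ l g, r h])).
Local Notation M := lcn_tensor.

Lemma nul1 : l 1 = 1.
Proof. by apply: (mulgI (l 1)); rewrite -nul_morph !mulg1. Qed.

Lemma nur1 : r 1 = 1.
Proof. by apply: (mulgI (r 1)); rewrite -nur_morph !mulg1. Qed.

Lemma nulV g : l g^-1 = (l g)^-1.
Proof. by apply: (mulgI (l g)); rewrite -nul_morph !mulgV nul1. Qed.

Lemma nurV g : r g^-1 = (r g)^-1.
Proof. by apply: (mulgI (r g)); rewrite -nur_morph !mulgV nur1. Qed.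

Lemma nulX g n : l (g ^+ n) = l g ^+ n.
Proof. by elim: n => [|n IHn]; rewrite ?nul1 // !expgS nul_morph IHn. Qed.

Lemma nulR g h : l [~ g, h] = [~ l g, l h].
Proof. by rewrite !commgEl !conjgE !nul_morph !nulV. Qed.

Lemma lcn_tensor_group s : is_subgroup (M s).
Proof. by rewrite /lcn_tensor -lock; apply: gen_subgroupP. Qed.
Let sM := lcn_tensor_group.

Lemma mem_lcn_tensor s g h : g \in 'L_s(G) -> M s [~ l g, r h].
Proof.
by rewrite /lcn_tensor -lock => gL; apply: mem_gen_subgroup; exists g, h.
Qed.

Lemma lcn_tensor_ind s (P : nu gT -> Prop) :
    @is_subgroup (nu gT) P -> (forall g h, g \in 'L_s(G) -> P [~ l g, r h]) ->
  forall x, M s x -> P x.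
Proof.
rewrite /lcn_tensor -lock => sP MP;
  apply: gen_subgroup_ind => // _ [g [h [gL ->]]].
exact: MP.
Qed.

Lemma lcn_tensor_leq s t x : s <= t -> M t x -> M s x.
Proof.
move=> le_st; apply: lcn_tensor_ind => // g h gL.
by apply: mem_lcn_tensor; apply: mem_lcn_leq le_st _.
Qed.

Lemma lcn_tensor1 s x : 'L_s(G) = 1 -> M s x -> x = 1.
Proof.
move=> L1; apply: (@lcn_tensor_ind _ (fun y => y = 1)) => [|g h].
  by split=> // y z -> ->; rewrite mulgV.
by rewrite L1 => /set1P->; rewrite nul1 comm1g.
Qed.

Lemma is_subgroup_conj (N : set (nu gT)) z :
  is_subgroup N -> is_subgroup (fun x => N (x ^ z)).
Proof.
move=> sN; split=> [|x y Nx Ny]; first by rewrite conj1g; apply: is_subgroup1.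
by rewrite conjMg conjVg; apply: sN.2.
Qed.

Lemma lcn_tensorJ s x z : M s x -> M s (x ^ z).
Proof.
have Ml y k : M s y -> M s (y ^ l k).
  apply: (@lcn_tensor_ind _ (fun y => M s (y ^ l k))) => [|g h gL].
    exact: is_subgroup_conj.
  by rewrite nu_relationl; apply: mem_lcn_tensor; rewrite lcnJ.
have Mr y k : M s y -> M s (y ^ r k).
  apply: (@lcn_tensor_ind _ (fun y => M s (y ^ r k))) => [|g h gL].
    exact: is_subgroup_conj.
  by rewrite -nu_relationr; apply: mem_lcn_tensor; rewrite lcnJ.
have [u ->] := nu_of_surj z; elim: u x => [|a u IHu] x Mx;
  first by rewrite conjg1.
rewrite -cat1s -nu_ofM conjgM; apply: IHu.
by case: a => k; [apply: Ml | apply: Mr].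
Qed.

(** Compare the two defining relations of nu(G) on the generators. *)
Lemma nur_conj_tensor x k : M 0 x -> x ^ r k = x ^ l k.
Proof.
apply: (@lcn_tensor_ind _ (fun y => y ^ r k = y ^ l k));
  last move=> g h _; last first.
  by rewrite -nu_relationr nu_relationl.
split=> [|x' y Ex Ey]; first by rewrite !conj1g.
by rewrite !conjMg !conjVg Ex Ey.
Qed.

(** On M_0, r h acts as l h, hence [l g, r h] acts as [l g, l h]. *)
Lemma tensor_conj x g h : M 0 x -> x ^ [~ l g, r h] = x ^ l [~ g, h].
Proof.
have commE (T : groupType) (y z : T) : [~ y, z] = y^-1 * z^-1 * y * z.
  by rewrite commgEl conjgE !mulgA.
move=> Mx; rewrite nulR !commE !conjgM -!nulV -nurV.
by rewrite !nur_conj_tensor //; do ?apply: lcn_tensorJ.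
Qed.

Lemma lcn_tensor_conj s w :
  M s w -> exists2 k, k \in 'L_s.+1(G) & forall x, M 0 x -> x ^ w = x ^ l k.
Proof.
pose P w := exists2 k, k \in 'L_s.+1(G) & forall x, M 0 x -> x ^ w = x ^ l k.
apply: (@lcn_tensor_ind _ P) => [|g h gL]; last first.
  by exists [~ g, h] => [|x Mx]; [apply: mem_lcnR | apply: tensor_conj].
split=> [|w1 w2 [k1 Lk1 Ek1] [k2 Lk2 Ek2]].
  by exists 1 => [|x _]; rewrite ?group1 // nul1.
exists (k1 * k2^-1) => [|x Mx]; first by rewrite groupM ?groupV.
rewrite nul_morph nulV !conjgM Ek1 //; set y := x ^ l k1.
have My : M 0 y by apply: lcn_tensorJ.
rewrite -{1}[y](conjgKV (l k2)) -Ek2 ?conjgK //.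
exact: lcn_tensorJ.
Qed.

Definition eqmod (N : set (nu gT)) x y := N (x^-1 * y).

Section Eqmod.
Variable s : nat.
Local Notation "x == y" := (eqmod (M s) x y).

Lemma eqmod_refl x : x == x.
Proof. by rewrite /eqmod mulVg; apply: (is_subgroup1 (sM _)). Qed.

Lemma eqmod_sym x y : x == y -> y == x.
Proof. by move=> xy; rewrite /eqmod -[x]invgK -invgM;
  apply: (is_subgroupV (sM s) xy). Qed.

Lemma eqmod_trans y x z : x == y -> y == z -> x == z.
Proof.
move=> xy yz; rewrite /eqmod -[z](mulVKg y) mulgA.
exact: is_subgroupM (sM s) xy yz.
Qed.

Lemma eqmodM x1 x2 y1 y2 : x1 == y1 -> x2 == y2 -> x1 * x2 == y1 * y2.
Proof.
move=> xy1 xy2; rewrite /eqmod.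
have -> : (x1 * x2)^-1 * (y1 * y2) = (x1^-1 * y1) ^ x2 * (x2^-1 * y2).
  by rewrite conjgE invgM -!mulgA mulVKg.
by apply: (is_subgroupM (sM _)) => //; apply: lcn_tensorJ.
Qed.

Lemma eqmodV x y : x == y -> x^-1 == y^-1.
Proof.
move=> xy; rewrite /eqmod; have -> : x^-1^-1 * y^-1 = (y^-1 * x) ^ x^-1.
  by rewrite conjgE !gnorm.
by apply: lcn_tensorJ; apply: eqmod_sym.
Qed.

Lemma eqmod1 x : M s x -> x == 1.
Proof. by move=> Mx; rewrite /eqmod mulg1; apply: (is_subgroupV (sM _)). Qed.

Lemma eqmod_mulR x y : M s [~ x, y] -> y * x == x * y.
Proof. by move=> Mxy; rewrite /eqmod (commgC x y) mulKg. Qed.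

End Eqmod.

Lemma tensor_eqmod_l s g g' h :
  g' * g^-1 \in 'L_s(G) -> eqmod (M s) [~ l g', r h] [~ l g, r h].
Proof.
move=> Lg; rewrite -{1}(mulgVK g g') nul_morph commMgJ_groupType.
rewrite -[X in eqmod _ _ X]mul1g; apply: eqmodM (eqmod_refl _ _).
by apply: eqmod1; apply: lcn_tensorJ; apply: mem_lcn_tensor.
Qed.

Lemma tensor_eqmod_r s g h h' : g \in 'L_s(G) ->
  eqmod (M s.+1) [~ l g, r (h * h')] ([~ l g, r h] * [~ l g, r h']).
Proof.
move=> Lg; rewrite (conjgCV h h') nur_morph commgMJ_groupType.
rewrite -nu_relationr conjgKV; apply: eqmodM (eqmod_refl _ _) _.
by apply: tensor_eqmod_l; apply: mem_lcn_divJ.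
Qed.

Hypothesis nilG : nilpotent G.

(** For g in L_s, the multiplicative map th : h |-> [l g, r h] modulo M_(s+1)
    kills L_2. Indeed th [u, v] is the commutator of th u and th v, and th v
    acts on M_0 as k = [g, v], which lies in L_(s+1); conjugation by k changes
    th u into th (u^k), that is, multiplies it by th [u, k]. As [u, k] lies two
    steps deeper than u in the lower central series, a descending induction
    shows that this factor is trivial. *)
Lemma tensor_der1 s g d :
  0 < s -> g \in 'L_s(G) -> d \in 'L_2(G) -> M s.+1 [~ l g, r d].
Proof.
move=> s_gt0 Lg Ld; have /lcnP[c Lc1] := nilG.
suffices: forall m t, c.+1 <= t.+2 + m -> d \in 'L_t.+2(G) ->
    M s.+1 [~ l g, r d].
  by move/(_ c 0); apply=> //; rewrite addSn ltnS leq_addl.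
move=> m; elim: m d Ld => [|m IHm] d _ t.
  rewrite addn0 => le_ct /(mem_lcn_leq le_ct).
  rewrite Lc1 => /set1P->; rewrite nur1 commg1; exact: (is_subgroup1 (sM _)).
move=> le_ct.
have L2 i h : h \in 'L_i.+2(G) -> h \in 'L_2(G).
  exact: mem_lcn_leq.
have {IHm} IH h : h \in 'L_t.+3(G) -> M s.+1 [~ l g, r h].
  by move=> Lx; apply: (IHm h (L2 _ _ Lx) t.+1) => //; rewrite addSnnS.
pose D := [set h | `[< M s.+1 [~ l g, r h] >]].
have gD : group_set D.
  apply/group_setP; split=> [|h k].
    by rewrite inE; apply/asboolP; rewrite nur1 commg1;
      apply: (is_subgroup1 (sM _)).
  rewrite !inE => /asboolP Mx /asboolP My; apply/asboolP.
  rewrite -[X in M _ X](mulVKg ([~ l g, r h] * [~ l g, r k])).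
  apply: (is_subgroupM (sM _)) => //; first exact: (is_subgroupM (sM _)).
  by apply: eqmod_sym; apply: tensor_eqmod_r.
suffices: 'L_t.+2(G) \subset Group gD.
  by move/subsetP=> LD /LD; rewrite inE => /asboolP.
rewrite lcnSn gen_subG; apply/subsetP=> _ /imset2P[u v Lu _ ->].
rewrite inE; apply/asboolP.
pose k := [~ g, v]; have Lk : k \in 'L_s.+1(G) by apply: mem_lcnR.
pose th h := [~ l g, r h].
have thM h h' : eqmod (M s.+1) (th (h * h')) (th h * th h').
  exact: tensor_eqmod_r.
have Mth h : M 0 (th h) by apply: mem_lcn_tensor; rewrite inE.
have th_uk : eqmod (M s.+1) (th u ^ l k) (th u).
  rewrite /th nu_relationl; apply: eqmod_trans (tensor_eqmod_l _ _) _.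
    exact: mem_lcn_divJ.
  rewrite -/(th _) -[u ^ k](mulVKg u) -commgEl -[X in eqmod _ _ X]mulg1.
  apply: eqmod_trans (thM _ _) (eqmodM (eqmod_refl _ _) (eqmod1 _)).
  apply: IH; apply: mem_lcn_der1R => //.
  by apply: mem_lcn_leq Lk.
have th_uv : eqmod (M s.+1) (th v * th u) (th u * th v).
  apply: eqmod_mulR; rewrite commgEl tensor_conj //.
  exact: eqmod_sym.
have : eqmod (M s.+1) (th v * th u * 1) (th v * th u * th [~ u, v]).
  rewrite mulg1; apply: eqmod_trans th_uv _.
  apply: eqmod_trans (eqmod_sym (thM _ _)) _; rewrite commgC.
  apply: eqmod_trans (thM _ _) _; apply: eqmodM (eqmod_refl _ _).
  exact: thM.
by rewrite /eqmod mulg1 mulKg.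
Qed.

(** Modulo M_(s+1), conjugation by l k replaces [l g, r h] with
    [l g, r (h^k)], and h^k differs from h by an element of L_2. *)
Lemma lcn_tensorR1 s x k : 0 < s -> M s x -> M s.+1 [~ x, l k].
Proof.
move=> s_gt0 Mx; rewrite commgEl.
move: x Mx; apply: (@lcn_tensor_ind _ (fun y => M s.+1 (y^-1 * y ^ l k))) =>
  [|g h Lg].
  split=> [|x y Mx My]; first by rewrite invg1 mul1g conj1g;
    apply: (is_subgroup1 (sM _)).
  by rewrite conjMg conjVg; apply: eqmodM => //; apply: eqmodV.
apply: eqmod_sym; rewrite nu_relationl.
apply: eqmod_trans (tensor_eqmod_l _ (mem_lcn_divJ _ Lg)) _.
rewrite -[h ^ k](mulVKg h) -commgEl -[X in eqmod _ _ X]mulg1.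
apply: eqmod_trans (tensor_eqmod_r _ _ Lg) (eqmodM (eqmod_refl _ _) (eqmod1 _)).
by apply: tensor_der1 => //; apply: mem_lcnR; rewrite inE.
Qed.

(** Induction on i: for u in L_i and v in G, conjugating an element of M_s
    by l (u v) or by l (v u) gives the same result modulo M_(i+1+s), because
    the corrections a = [y, l u] and b = [y, l v] satisfy a^v = a, b^u = b and
    a b = b a modulo that subgroup. *)
Lemma lcn_tensorRl i s x k :
  0 < i -> 0 < s -> M s x -> k \in 'L_i(G) -> M (i + s) [~ x, l k].
Proof.
case: i => // i _; elim: i s x k => [|i IHi] s x k s_gt0 Mx Lk.
  by rewrite add1n; apply: lcn_tensorR1.
pose D := [set k | `[< forall x, M s x -> M (i.+2 + s) [~ x, l k] >]].
have gD : group_set D.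
  apply/group_setP; split=> [|k1 k2].
    rewrite inE; apply/asboolP=> y _; rewrite nul1 commg1;
      exact: (is_subgroup1 (sM _)).
  rewrite !inE => /asboolP D1 /asboolP D2; apply/asboolP=> y My.
  rewrite nul_morph commgMJ_groupType; apply: (is_subgroupM (sM _)) => //;
    first exact: D2.
  by apply: lcn_tensorJ; apply: D1.
suffices: 'L_i.+2(G) \subset Group gD.
  by move/subsetP/(_ _ Lk); rewrite inE => /asboolP; apply.
rewrite lcnSn gen_subG; apply/subsetP=> _ /imset2P[u v Lu _ ->].
rewrite inE; apply/asboolP => {x k Mx Lk} x Mx.
pose y := x ^ (l (v * u))^-1; have My : M s y by apply: lcn_tensorJ.
have xE : x = (y ^ l v) ^ l u by rewrite -conjgM -nul_morph conjgKV.
have xuvE : x ^ l [~ u, v] = (y ^ l u) ^ l v.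
  by rewrite xE -!conjgM -!nul_morph mulgA -commgC.
rewrite commgEl xuvE xE -/(eqmod _ _ _).
pose a := [~ y, l u]; pose b := [~ y, l v].
have Ma : M (i.+1 + s) a by apply: IHi.
have Mb : M s.+1 b by apply: lcn_tensorR1.
have conjE z w : z ^ w = z * [~ z, w] by rewrite commgEl mulVKg.
rewrite (conjE y (l u)) (conjE y (l v)) -/a -/b (conjMg y b) (conjMg y a)
  !(conjE y) -/a -/b.
rewrite -(mulgA y a) -(mulgA y b); apply: eqmodM (eqmod_refl _ _) _.
have ab : eqmod (M (i.+2 + s)) (b * a) (a * b).
  apply: eqmod_mulR; have [k _ Ek] := lcn_tensor_conj Mb.
  rewrite commgEl Ek -?commgEl; last exact: lcn_tensor_leq Ma.
  by rewrite addSn; apply: lcn_tensorR1; rewrite ?addn_gt0.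
have bu : eqmod (M (i.+2 + s)) (b ^ l u) b.
  rewrite -{2}[b]mulg1 conjE; apply: eqmodM (eqmod_refl _ _) (eqmod1 _).
  by rewrite addSnnS; apply: IHi.
have av : eqmod (M (i.+2 + s)) (a ^ l v) a.
  rewrite -{2}[a]mulg1 conjE; apply: eqmodM (eqmod_refl _ _) (eqmod1 _).
  by rewrite addSn; apply: lcn_tensorR1; rewrite ?addn_gt0.
apply: eqmod_trans (eqmodM (eqmod_refl _ _) bu) _.
apply: eqmod_trans (eqmod_sym ab) _.
exact: eqmodM (eqmod_refl _ _) (eqmod_sym av).
Qed.

Lemma lcn_tensorR s t x y :
  0 < s -> 0 < t -> M s x -> M t y -> M (s + t) [~ x, y].
Proof.
move=> s_gt0 t_gt0 Mx My; have [k Lk Ek] := lcn_tensor_conj My.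
rewrite commgEl Ek -?commgEl; last exact: lcn_tensor_leq Mx.
apply: (@lcn_tensor_leq _ (t.+1 + s)); first by rewrite addnC addSn.
exact: lcn_tensorRl.
Qed.

Section Filtration.
Variables (A : {group gT}) (j : nat).
Hypotheses (cAA : abelian A) (sAL : A \subset 'L_j(G)) (j_gt0 : 0 < j).

(** This is the filtration with H_0 = H_1 = l(A) M_j, and H_s = M_(s j) for
    s > 1. Adjoining A allows powers of l g to be combined with elements
    of M_j; A has to be abelian for [H_1, H_1] <= H_2 to hold. *)
Definition tensor_filt s : set (nu gT) := fun z => exists k m,
  [/\ k \in A, 1 < s -> k = 1, M (maxn s 1 * j) m & z = l k * m].

Lemma tensor_filt_group s : is_subgroup (tensor_filt s).
Proof.
split=> [|_ _ [k1 [m1 [A1 s1 M1 ->]]] [k2 [m2 [A2 s2 M2 ->]]]].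
  by exists 1, 1; rewrite group1 nul1 mulg1; split=> //;
    apply: (is_subgroup1 (sM _)).
exists (k1 * k2^-1), ((m1 * m2^-1) ^ (l k2)^-1); split.
- by rewrite groupM ?groupV.
- by move=> s_gt1; rewrite s1 ?s2 ?mulgV.
- by apply: lcn_tensorJ; apply: (sM _).2.
by rewrite nul_morph nulV conjgE invgM invgK -!mulgA mulKg.
Qed.

Lemma mem_tensor_filt s m : M (maxn s 1 * j) m -> tensor_filt s m.
Proof. by move=> Mm; exists 1, m; rewrite group1 nul1 mul1g. Qed.

Lemma tensor_filtration : filtration tensor_filt.
Proof.
have gt0 s : 0 < maxn s 1 * j by rewrite muln_gt0 leq_maxr.
split=> [|s _ [k [m [Ak sk Mm ->]]]|]; first exact: tensor_filt_group.
  exists k, m; split=> //; first by move=> /ltnW/sk.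
  apply: lcn_tensor_leq Mm; rewrite leq_mul2r; apply/orP; right.
  by rewrite geq_max !leq_max leqnn leqnSn orbT.
move=> s t _ _ [k1 [m1 [A1 s1 M1 ->]]] [k2 [m2 [A2 s2 M2 ->]]].
have aux s' t' k m : k \in A -> (1 < s' -> k = 1) -> M (maxn t' 1 * j) m ->
    M ((maxn s' 1 + maxn t' 1) * j) [~ m, l k].
  move=> Ak; case: (leqP s' 1) => [_ _|_ /(_ isT)->] Mm; last first.
    by rewrite nul1 commg1; apply: (is_subgroup1 (sM _)).
  rewrite mulnDl mul1n; apply: lcn_tensorRl => //.
  exact: (subsetP sAL).
apply: mem_tensor_filt; apply: (@lcn_tensor_leq _ ((maxn s 1 + maxn t 1) * j)).
  by rewrite leq_mul2r geq_max leq_add ?leq_maxl ?orbT //= ltn_addr ?leq_maxr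
    ?orbT.
have com : [~ l k1, l k2] = 1.
  by rewrite -nulR (_ : [~ k1, k2] = 1) ?nul1 //; apply/eqP/commgP;
    apply: (centsP cAA).
rewrite commMgJ_groupType; apply: (is_subgroupM (sM _)) => //;
  first apply: lcn_tensorJ.
  rewrite commgMJ_groupType com conj1g mulg1 -invgR;
    apply: (is_subgroupV (sM _)) => //.
  exact: aux.
rewrite commgMJ_groupType; apply: (is_subgroupM (sM _)) => //.
  by rewrite mulnDl; apply: lcn_tensorR.
by apply: lcn_tensorJ; rewrite addnC; apply: aux.
Qed.

End Filtration.

Variables (p a : nat).
Hypotheses (p_pr : prime p) (expG : forall g, g ^+ (p ^ a) = 1).

(** Descending induction on j >= s for the elements of M_j, starting from
    M_(p s). As H_2 = M_(2 j) lies in M_(j+1), the induction hypothesis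
    controls the e-th powers in H_2. *)
Lemma lcn_tensor_pexp s x : 0 < s -> M s x -> M (p * s) (x ^+ (p ^ a)).
Proof.
move=> s_gt0; set e := (p ^ a)%N; set N := M (p * s).
suffices: forall m j y, s <= j -> p * s <= j + m -> M j y -> N (y ^+ e).
  by apply=> //; apply: leq_addl.
elim=> [|m IHm] j y le_sj le_m.
  by rewrite addn0 in le_m => My; apply: is_subgroupX (sM _) _;
    apply: lcn_tensor_leq le_m _.
have {}IHm z : M j.+1 z -> N (z ^+ e).
  by apply: IHm; rewrite ?addSnnS // ltnW.
have j_gt0 : 0 < j by apply: leq_trans le_sj.
have HpN (A : {group gT}) z : tensor_filt A j p z -> N z.
  have p_gt1 := prime_gt1 p_pr.
  case=> k [n [_ /(_ p_gt1)-> Mn ->]]; rewrite nul1 mul1g.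
  apply: lcn_tensor_leq Mn; rewrite (maxn_idPl (ltnW p_gt1)).
  by rewrite leq_mul2l le_sj orbT.
have H2N (A : {group gT}) z : tensor_filt A j 2 z -> N (z ^+ e).
  case=> k [n [_ /(_ isT)-> Mn ->]]; rewrite nul1 mul1g; apply: IHm.
  by apply: lcn_tensor_leq Mn; rewrite mul2n -addnn -addn1 leq_add2l.
move=> My; suffices [] : M j y /\ N (y ^+ e) by [].
move: y My; apply: (@lcn_tensor_ind _ (fun y => M j y /\ N (y ^+ e))) =>
  [|g h Lg].
  split=> [|x' y [Mx Nx] [My Ny]].
    by rewrite expg1n; split; apply: (is_subgroup1 (sM _)).
  split; first exact: (sM j).2.
  have fH := @tensor_filtration 1%G j (abelian1 _) (sub1G _) j_gt0.
  apply: (pexp_of_product fH p_pr (sM _) (HpN _) (H2N _)) => //.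
  - by apply: mem_tensor_filt; rewrite mul1n.
  - by apply: mem_tensor_filt; rewrite mul1n; apply: (is_subgroupV (sM _)).
  by rewrite expVgn; apply: (is_subgroupV (sM _)).
split; first exact: mem_lcn_tensor.
have sgL : <[g]> \subset 'L_j(G) by rewrite cycle_subG.
have fH := tensor_filtration (cycle_abelian g) sgL j_gt0.
apply: (pexp_of_quotient fH p_pr (sM _) (HpN _) (H2N _) (x := l g)).
- exists g, 1; rewrite cycle_id mulg1; split=> //.
  exact: (is_subgroup1 (sM _)).
- by apply: mem_tensor_filt; rewrite mul1n; apply: mem_lcn_tensor.
- by rewrite -nulX expG nul1.
by rewrite commgEl mulVKg -conjXg -nulX expG nul1 conj1g.
Qed.

Lemma lcn_tensor_pexp_iter m x : M 1 x -> M (p ^ m) (x ^+ ((p ^ a) ^ m)).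
Proof.
move=> Mx; elim: m => [|m IHm]; first by rewrite !expn0 expg1.
rewrite [((p ^ a) ^ _)%N]expnSr expgnA expnS.
by apply: lcn_tensor_pexp; rewrite // expn_gt0 prime_gt0.
Qed.

End Tensor.

(** * The exponent of the tensor square *)

Section Exponent.
Local Open Scope group_scope.

Lemma exp_of_dvdn (T : groupType) (H : set T) m :
  0 < m -> (forall x, H x -> x ^+ m = 1) -> exp_of H %| m.
Proof.
move=> m_gt0 Hm; rewrite /exp_of; case: pselect => [exH|[]]; last first.
  by exists m; rewrite /is_expo m_gt0; apply/asboolP.
case: ex_minnP => q /andP[q_gt0 /asboolP Hq] min_q.
rewrite /dvdn; case: (posnP (m %% q)) => [//|r_gt0].
have /min_q : is_expo H (m %% q).
  rewrite /is_expo r_gt0; apply/asboolP => x Hx.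
  by have := Hm x Hx; rewrite {1}(divn_eq m q) expgnDr mulnC expgnA Hq //
    expg1n mul1g.
by rewrite leqNgt ltn_pmod.
Qed.

End Exponent.

Section PGroup.
Local Open Scope group_scope.

Lemma nu_tensor_expn (p : nat) (gT : finGroupType) (x : nu gT) :
    prime p -> p.-group [set: gT] -> nu_tensor gT x ->
  x ^+ (exponent [set: gT] ^ up_log p (nil_class [set: gT]).+1) = 1.
Proof.
move=> p_pr pG; set G := [set: gT]; have nilG := pgroup_nil pG.
have /p_natP[a expGa] : p.-nat (exponent G) by rewrite pnat_exponent.
have expG (g : gT) : g ^+ (p ^ a) = 1 by rewrite -expGa expg_exponent ?inE.
have L1 : 'L_(p ^ up_log p (nil_class G).+1)(G) = 1.
  apply/trivgP; rewrite -(elimT (lcn_nil_classP _ nilG) (leqnn _)).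
  by apply/lcn_sub_leq/up_logP/prime_gt1.
move=> Tx; apply: lcn_tensor1 L1 _; rewrite expGa.
apply: lcn_tensor_pexp_iter => //.
move: x Tx; apply: gen_subgroup_ind; first exact: lcn_tensor_group.
by move=> _ [g [h ->]]; apply: mem_lcn_tensor; rewrite inE.
Qed.

End PGroup.

Theorem theorem1p4 (p : nat) (gT : finGroupType) (c n : nat) :
  prime p -> (p.-group [set: gT])%g -> nil_class [set: gT] = c ->
  n = up_log p c.+1 ->
  exp_of (nu_tensor gT) %| (exponent [set: gT]) ^ n.
Proof.
move=> p_pr pG <- ->; apply: exp_of_dvdn => [|x Tx].
  by rewrite expn_gt0 exponent_gt0.
exact: nu_tensor_expn.
Qed.
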